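(* Let $\mathbb{F}$ be $\mathbb{R}$ or $\mathbb{C}$, and let $\{\mathcal{K}_i\}_{i=1}^b$ be subsets of $\{1,\dots,n\}$ that form a $\mathrm{BIBD}(n,k,\lambda)$ for some $k\geq2$, $\lambda>0$. For each $i=1,\dots,b$, let $\{c_{i,j}\}_{j\in\mathcal{K}_i}$ be unimodular scalars in $\mathbb{F}$, and suppose that $$\overline{c_{i,j}}\,c_{i,j'}=\overline{c_{i',j}}\,c_{i',j'}\quad\text{for all } i\neq i',\ j\neq j'\text{ such that } j,j'\in\mathcal{K}_i\cap\mathcal{K}_{i'}.$$ Then the columns $\{\psi_j\}_{j=1}^n$ of the matrix $\Psi\in\mathbb{F}^{b\times n}$ defined by $$\Psi(i,j)=\begin{cases}\frac{1}{\sqrt{\lambda}}\,c_{i,j},& j\in\mathcal{K}_i,\\ 0,& j\notin\mathcal{K}_i,\end{cases}$$ are equiangular. Moreover, if $\{\psi_j\}_{j=1}^n$ is an equiangular tight frame (ETF) for its span, then this span is necessarily of dimension $$\frac{n(n-1)}{(n-1)+(k-1)^2},$$ and for every Naimark complement $\{\varphi_j\}_{j=1}^n$ of $\{\psi_j\}_{j=1}^n$ and every $i=1,\dots,b$, the subset $\{\varphi_j\}_{j\in\mathcal{K}_i}$ is a regular simplex.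
   Context: For positive integers $v>k\geq2$ and $\lambda$, a $\mathrm{BIBD}(v,k,\lambda)$ (balanced incomplete block design) is a $v$-element vertex set (here $\{1,\dots,n\}$ with $v=n$) together with a finite family of subsets called blocks such that every block contains exactly $k$ vertices and every pair of distinct vertices is contained in exactly $\lambda$ blocks. Inner products are conjugate-linear in the first argument. A finite sequence of nonzero vectors is equiangular if all vectors have equal norm and $|\langle\psi_j,\psi_{j'}\rangle|$ is constant over all $j\neq j'$. It is an $a$-tight frame for a Hilbert space $\mathbb{H}$ ($a>0$) if $\sum_{j}\langle\psi_j,y\rangle\psi_j=ay$ for all $y\in\mathbb{H}$, and an ETF for $\mathbb{H}$ if it is equiangular and a tight frame for $\mathbb{H}$. For a positive integer $s$, a regular $s$-simplex is a sequence of $s+1$ vectors that is an ETF for its span, where this span has dimension $s$; a regular simplex is a regular $s$-simplex for some $s$. If $\{\psi_j\}_{j=1}^n$ is an $a$-tight frame for its span and this span has dimension less than $n$, a Naimark complement of it is a sequence $\{\varphi_j\}_{j=1}^n$ of vectors in a Hilbert space over $\mathbb{F}$ with $\Phi^*\Phi=a\mathbf{I}-\Psi^*\Psi$, where $(\Psi^*\Psi)(j,j')=\langle\psi_j,\psi_{j'}\rangle$ and $(\Phi^*\Phi)(j,j')=\langle\varphi_j,\varphi_{j'}\rangle$ are the Gram matrices. *)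

(* Defs.v *)
From HB Require Import structures.
From mathcomp Require Import all_boot all_order all_algebra.
From mathcomp Require Import reals.
From mathcomp.real_closed Require Import complex.

Set Implicit Arguments.
Unset Strict Implicit.
Unset Printing Implicit Defensive.

Import Order.TTheory GRing.Theory Num.Theory.

Local Open Scope ring_scope.

(* The base field is either the reals R or the complex numbers R[i]. *)
Variant scalar_kind := RealScalars | ComplexScalars.

Definition base_field (R : realType) (k : scalar_kind) : numFieldType :=
  match k with
  | RealScalars => R : numFieldType
  | ComplexScalars => R[i] : numFieldType
  end.

Definition conj (R : realType) (k : scalar_kind) :
    {rmorphism base_field R k -> base_field R k} :=
  match k return {rmorphism base_field R k -> base_field R k} with
  | RealScalars => idfun
  | ComplexScalars => @conjc R
  end.

Definition of_real (R : realType) (k : scalar_kind) : R -> base_field R k :=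
  match k return R -> base_field R k with
  | RealScalars => id
  | ComplexScalars => real_complex R
  end.

Definition real_part (R : realType) (k : scalar_kind) : base_field R k -> R :=
  match k return base_field R k -> R with
  | RealScalars => id
  | ComplexScalars => @complex.Re R
  end.

Arguments conj {R} k.
Arguments of_real {R} k x.
Arguments real_part {R k} x.

Lemma conj_involutive (R : realType) (k : scalar_kind) :
  involutive (@conj R k).
Proof. by case: k => //= x; exact: conjcK. Qed.

Lemma mul_conj_ge0 (R : realType) (k : scalar_kind) (x : base_field R k) :
  0 <= x * conj k x.
Proof.
case: k x => /= x; first by rewrite -expr2 sqr_ge0.
exact: mulcJ_ge0.
Qed.

Section InnerProduct.
Variables (R : realType) (k : scalar_kind) (V : lmodType (base_field R k)).
Variable dot : {dot V for conj k}.

(* The library's forms are linear in their first argument and conjugate-linear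
   in the second; swapping the arguments gives an inner product that is
   conjugate-linear in the first argument. *)
Definition inner (x y : V) : base_field R k := dot y x.

Definition hnorm (x : V) : R := Num.sqrt (real_part (inner x x)).

(* Completeness: (V, dot) is a Hilbert space. *)
Definition hilbert : Prop :=
  forall u : nat -> V,
    (forall e : R, 0 < e -> exists N : nat, forall p q : nat,
        (N <= p)%N -> (N <= q)%N -> hnorm (u p - u q) < e) ->
    exists l : V, forall e : R, 0 < e -> exists N : nat, forall p : nat,
        (N <= p)%N -> hnorm (u p - l) < e.

Section Family.
Variables (I : finType) (psi : I -> V).

Definition in_span (x : V) : Prop :=
  exists a : I -> base_field R k, x = \sum_j a j *: psi j.

Definition lin_indep : Prop :=
  forall a : I -> base_field R k, \sum_j a j *: psi j = 0 -> forall j, a j = 0.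

Definition equiangular : Prop :=
  [/\ forall j, psi j != 0,
      forall j j', hnorm (psi j) = hnorm (psi j')
    & forall j j' l l', j != j' -> l != l' ->
        `|inner (psi j) (psi j')| = `|inner (psi l) (psi l')| ].

(* S is the subspace playing the role of the Hilbert space being framed. *)
Definition tight_frame_for (S : V -> Prop) (a : R) : Prop :=
  [/\ 0 < a, forall j, S (psi j)
    & forall y, S y ->
        \sum_j inner (psi j) y *: psi j = of_real k a *: y].

Definition ETF_for (S : V -> Prop) : Prop :=
  equiangular /\ exists a : R, tight_frame_for S a.

End Family.

Definition has_dim (S : V -> Prop) (d : nat) : Prop :=
  exists e : 'I_d -> V, lin_indep e /\ forall x, S x <-> in_span e x.

Definition regular_s_simplex (s : nat) (I : finType) (psi : I -> V) : Prop :=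
  [/\ #|I| = s.+1, ETF_for psi (in_span psi) & has_dim (in_span psi) s].

Definition regular_simplex (I : finType) (psi : I -> V) : Prop :=
  exists s : nat, (0 < s)%N /\ regular_s_simplex s psi.

End InnerProduct.

Definition naimark_complement (R : realType) (k : scalar_kind)
    (V H : lmodType (base_field R k))
    (dotV : {dot V for conj k}) (dotH : {dot H for conj k})
    (n : nat) (psi : 'I_n -> V) (phi : 'I_n -> H) : Prop :=
  hilbert dotH /\
  exists a : R,
    [/\ tight_frame_for dotV psi (in_span psi) a,
        exists d : nat, has_dim (in_span psi) d /\ (d < n)%N
      & forall j j', inner dotH (phi j) (phi j') =
          of_real k a *+ (j == j') - inner dotV (psi j) (psi j')].

Section ColumnSpace.
Variables (R : realType) (k : scalar_kind) (b : nat).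
Local Notation F := (base_field R k).

Definition coldot (u v : 'cV[F]_b) : F := \sum_i u i 0 * conj k (v i 0).

Fact coldot_additivel v : zmod_morphism (coldot ^~ v).
Proof.
by move=> x y; rewrite /coldot -sumrB; apply: eq_bigr => i _; rewrite !mxE mulrBl.
Qed.

Fact coldot_additiver u : zmod_morphism (coldot u).
Proof.
move=> x y; rewrite /coldot -sumrB; apply: eq_bigr => i _.
by rewrite !mxE rmorphB mulrBr.
Qed.

Fact coldot_scalablel v : scalable_for *%R (coldot ^~ v).
Proof.
by move=> a x; rewrite /coldot mulr_sumr; apply: eq_bigr => i _; rewrite !mxE mulrA.
Qed.

Fact coldot_scalabler u : scalable_for (conj k \; *%R) (coldot u).
Proof.
move=> a x; rewrite /coldot /= mulr_sumr; apply: eq_bigr => i _.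
by rewrite !mxE rmorphM mulrCA.
Qed.

Fact coldot_hermitian (x y : 'cV[F]_b) :
  coldot x y = (-1) ^+ false * conj k (coldot y x).
Proof.
rewrite mul1r /coldot rmorph_sum; apply: eq_bigr => i _.
by rewrite rmorphM conj_involutive mulrC.
Qed.

Fact coldot_gt0 (u : 'cV[F]_b) : u != 0 -> 0 < coldot u u.
Proof.
move=> u0; rewrite lt0r sumr_ge0 ?andbT; last by move=> i _; exact: mul_conj_ge0.
apply: contra u0; rewrite psumr_eq0 => [/allP u0|i _]; last exact: mul_conj_ge0.
apply/eqP/matrixP => i j; rewrite mxE ord1.
have := u0 i (mem_index_enum _); rewrite mulf_eq0 fmorph_eq0 orbb.
by move/eqP.
Qed.

HB.instance Definition _ :=
  @isBilinear.Build F 'cV[F]_b 'cV[F]_b F *%R (conj k \; *%R) coldot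
    coldot_additivel coldot_additiver coldot_scalablel coldot_scalabler.
HB.instance Definition _ :=
  @isHermitianSesquilinear.Build F 'cV[F]_b false (conj k) coldot
    coldot_hermitian.
HB.instance Definition _ := @isDotProduct.Build F 'cV[F]_b coldot coldot_gt0.

Definition std_dot : {dot 'cV[F]_b for conj k} := coldot.

End ColumnSpace.

Arguments std_dot R k b : clear implicits.

(* The vertex set is 'I_n, so v = n; blocks form an indexed family and may be
   repeated. *)
Definition BIBD (n k lam b : nat) (K : 'I_b -> {set 'I_n}) : Prop :=
  [/\ (2 <= k)%N, (k < n)%N, (0 < lam)%N,
      forall i, #|K i| = k
    & forall j j', j != j' -> #|[set i | (j \in K i) && (j' \in K i)]| = lam].

(* Only the values c i j with j \in K i matter. *)
Definition synthesis (R : realType) (kF : scalar_kind) (n lam b : nat)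
    (K : 'I_b -> {set 'I_n}) (c : 'I_b -> 'I_n -> base_field R kF) :
    'M[base_field R kF]_(b, n) :=
  \matrix_(i, j)
    if j \in K i then of_real kF (Num.sqrt lam%:R)^-1 * c i j else 0.

(* Main.v *)
Require Import Defs.
From mathcomp Require Import all_boot all_order all_algebra.
From mathcomp Require Import reals.
From mathcomp.real_closed Require Import complex.
From mathcomp Require Import ring.

Set Implicit Arguments.
Unset Strict Implicit.
Unset Printing Implicit Defensive.

Import Order.TTheory GRing.Theory Num.Theory.
Local Open Scope ring_scope.

(** Write [g = (n-1)/(k-1)].  Counting the flags at a vertex shows that every
    vertex lies in [lam * g] blocks, so every column has squared norm [g].  The
    inner product of two distinct columns is an average over the [lam] blocks
    containing both vertices, and the coherence condition says that all the
    averaged terms agree.  It is therefore unimodular, and on a block [K i] the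
    Gram matrix of the columns is [g - 1] times the identity plus the rank one
    matrix of entries [conj (c i j) * c i j'] ([inner_diag], [inner_block]).
    Equiangularity follows.

    If the columns form an [a]-tight frame for their span, expanding a column in
    the frame gives [a * g = g ^ 2 + (n - 1)], whence [a = g + (k - 1)]
    ([synthesis_frame_bound]).  The trace of the Gram matrix is [n * g]; on the
    other hand this matrix is [a] times a projection onto a space whose dimension
    is that of the span, so its trace is [a] times that dimension
    ([tight_frame_dim]), and the formula drops out.

    Finally, [a - g = k - 1], so the Gram matrix of a Naimark complement over
    [K i] is [k] times the identity minus [conj (c i j) * c i j'].  The [k]
    scalars [conj (c i j)] form a vector of squared norm [k], so this matrix is [k]
    times the projection onto the hyperplane orthogonal to that vector.  Such a
    Gram matrix forces a regular simplex in any inner product space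
    ([regular_simplex_of_gram]): the only linear relation is
    [\sum_j conj (c i j) *: phi j = 0], which makes the frame [k]-tight and its
    span of dimension [k - 1]. *)

(** * Scalars *)

Section Scalars.
Variables (R : realType) (kF : scalar_kind).
Implicit Types (x : base_field R kF) (a b : R).

Lemma normX2_conj x : `|x| ^+ 2 = x * conj kF x.
Proof.
case: kF x => /= x; last exact: sqr_normc.
by rewrite real_normK ?num_real // expr2.
Qed.

Lemma norm_conj x : `|conj kF x| = `|x|.
Proof. by case: kF x => //= x; exact: normcJ. Qed.

Lemma conj_of_real a : conj kF (of_real kF a) = of_real kF a.
Proof. by case: kF => //=; exact: conjc_real. Qed.

Lemma of_realM a b : of_real kF (a * b) = of_real kF a * of_real kF b.
Proof. by case: kF => //=; exact: rmorphM. Qed.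

Lemma of_realV a : of_real kF a^-1 = (of_real kF a)^-1.
Proof. by case: kF => //=; exact: fmorphV. Qed.

Lemma of_real_nat m : of_real kF (m%:R : R) = m%:R.
Proof. by case: kF => //=; exact: rmorph_nat. Qed.

End Scalars.

(** * Frames and dimension in an inner product space *)

Section InnerProductFacts.
Variables (R : realType) (kF : scalar_kind) (V : lmodType (base_field R kF)).
Variable dot : {dot V for conj kF}.
Implicit Types (x y : V).

Lemma inner_sumr (I : finType) x (a : I -> base_field R kF) (v : I -> V) :
  inner dot x (\sum_j a j *: v j) = \sum_j a j * inner dot x (v j).
Proof.
rewrite /inner linear_sumlz; apply: eq_bigr => j _.
by rewrite linearZl_LR.
Qed.

Lemma innerZr x y (a : base_field R kF) :
  inner dot x (a *: y) = a * inner dot x y.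
Proof. by rewrite /inner linearZl_LR. Qed.

Lemma inner_conj x y : inner dot x y = conj kF (inner dot y x).
Proof. by rewrite /inner hermC expr0 mul1r. Qed.

Lemma inner_eq0 x : inner dot x x = 0 -> x = 0.
Proof.
move=> x0; apply/eqP/negP => /negP /(neq0_dnorm_gt0 (s := dot)).
by rewrite -/(inner dot x x) x0 ltxx.
Qed.

Lemma mem_span (I : finType) (psi : I -> V) l : in_span psi (psi l).
Proof.
exists (fun j => (j == l)%:R); rewrite (bigD1 l) //= eqxx scale1r big1 ?addr0 //.
by move=> j /negPf ->; rewrite scale0r.
Qed.

(** Pair the frame expansion of [psi l] with [psi l] itself; for an equiangular
    family all the terms on the right are known, and this determines [a]. *)
Lemma tight_frame_norm (I : finType) (psi : I -> V) a l :
  tight_frame_for dot psi (in_span psi) a ->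
  of_real kF a * inner dot (psi l) (psi l) =
    \sum_j `|inner dot (psi j) (psi l)| ^+ 2.
Proof.
case=> _ _ /(_ _ (mem_span psi l)) tight; rewrite -innerZr -tight inner_sumr.
by apply: eq_bigr => j _; rewrite normX2_conj -inner_conj.
Qed.

(** A basis extracted from a family is indexed by a subset of its index type,
    whereas [has_dim] asks for one indexed by an ordinal: [enum_val] transports
    it. *)
Lemma has_dim_subfamily (I : finType) (phi : I -> V) (A : {set I}) :
  (forall a : I -> base_field R kF, \sum_(j in A) a j *: phi j = 0 ->
     forall j, j \in A -> a j = 0) ->
  (forall j, exists a : I -> base_field R kF,
     phi j = \sum_(l in A) a l *: phi l) ->
  has_dim (in_span phi) #|A|.
Proof.
move=> indep gen; exists (fun i => phi (enum_val i)).
(* Extension by zero of a coefficient vector from the ordinal to [I]. *)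
pose ext (u : 'I_#|A| -> base_field R kF) j := \sum_(i | enum_val i == j) u i.
have ext_val u i : ext u (enum_val i) = u i.
  by rewrite /ext (big_pred1 i) // => i'; rewrite (inj_eq enum_val_inj).
have extE u : \sum_(j in A) ext u j *: phi j = \sum_i u i *: phi (enum_val i).
  by rewrite big_enum_val; apply: eq_bigr => i _; rewrite ext_val.
split=> [u | x].
  rewrite -extE => /indep u0 i; rewrite -ext_val; apply: u0; exact: enum_valP.
split=> [[a ->] | [u ->]].
  have [m phiE] := fin_all_exists gen.
  exists (fun i => \sum_j a j * m j (enum_val i)).
  under eq_bigr => j _ do rewrite phiE scaler_sumr big_enum_val.
  rewrite exchange_big /=; apply: eq_bigr => i _; rewrite scaler_suml.
  by apply: eq_bigr => j _; rewrite scalerA.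
exists (fun j => if j \in A then ext u j else 0); rewrite -extE big_mkcond /=.
by apply: eq_bigr => j _; case: ifP => // _; rewrite scale0r.
Qed.

(** * Regular simplices *)

Section SimplexFromGram.
Variables (I : finType) (phi : I -> V) (w : I -> base_field R kF).
Hypothesis card_gt1 : (1 < #|I|)%N.
Hypothesis w_unit : forall j, `|w j| = 1.
Hypothesis gram : forall j l,
  inner dot (phi j) (phi l) = #|I|%:R *+ (j == l) - conj kF (w j) * w l.

Let unit_conj j : w j * conj kF (w j) = 1.
Proof. by rewrite -normX2_conj w_unit expr1n. Qed.

Let w_neq0 j : w j != 0.
Proof. by rewrite -normr_eq0 w_unit oner_eq0. Qed.

Let gram_comb (a : I -> base_field R kF) l :
  inner dot (phi l) (\sum_j a j *: phi j) =
    #|I|%:R * a l - conj kF (w l) * \sum_j a j * w j.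
Proof.
rewrite inner_sumr mulr_sumr.
under eq_bigr => j _ do rewrite gram mulrBr.
rewrite sumrB (bigD1 l) //= eqxx mulr1n big1 ?addr0; last first.
  by move=> j; rewrite eq_sym => /negPf ->; rewrite mulr0n mulr0.
by rewrite mulrC; congr (_ - _); apply: eq_bigr => j _; rewrite mulrCA.
Qed.

(** The combination is orthogonal to every [phi l], because the vector
    [conj (w j)] lies in the kernel of the Gram matrix; lying in the span of the
    [phi l], it is orthogonal to itself. *)
Let simplex_relation : \sum_j conj kF (w j) *: phi j = 0.
Proof.
set x := \sum_j _.
have orth l : inner dot (phi l) x = 0.
  rewrite gram_comb (eq_bigr (fun=> 1)) => [|j _]; last by rewrite mulrC.
  by rewrite sumr_const mulrC subrr.
apply: (@inner_eq0 _); rewrite {2}/x inner_sumr big1 // => j _.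
by rewrite inner_conj orth rmorph0 mulr0.
Qed.

Let gram_diag j : inner dot (phi j) (phi j) = #|I|.-1%:R.
Proof.
rewrite gram eqxx mulr1n mulrC unit_conj -{1}(prednK (ltnW card_gt1)).
by rewrite -natr1 addrK.
Qed.

Let phi_neq0 j : phi j != 0.
Proof.
apply/eqP => phi0; have := gram_diag j; rewrite phi0 /inner linear0l.
apply/eqP; rewrite eq_sym pnatr_eq0 -lt0n -subn1 subn_gt0.
exact: card_gt1.
Qed.

(** By [gram_comb] the frame operator is [#|I|] times the identity, up to a
    multiple of the combination that vanishes by [simplex_relation].  This
    relation also expresses any one vector through the others, and these are
    independent since the kernel of the Gram matrix is spanned by the nowhere
    vanishing vector [conj (w j)]. *)
Lemma regular_simplex_of_gram : regular_simplex dot phi.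
Proof.
exists #|I|.-1; split; first by rewrite -subn1 subn_gt0.
split; first by rewrite prednK // ltnW.
- split.
    split=> // [j l | j l j' l' neq_jl neq_jl'].
      by rewrite /hnorm !gram_diag.
    rewrite !gram (negPf neq_jl) (negPf neq_jl') !mulr0n !sub0r !normrN.
    by rewrite !normrM !norm_conj !w_unit.
  exists #|I|%:R; split=> [|j|y [a ->]].
  + by rewrite ltr0n ltnW.
  + exact: mem_span.
  under eq_bigr => j _ do rewrite gram_comb scalerBl -scalerA.
  rewrite sumrB -scaler_sumr of_real_nat.
  under [X in _ - X]eq_bigr => j _ do rewrite mulrC -scalerA.
  by rewrite -scaler_sumr simplex_relation scaler0 subr0.
have [j0 _] : exists j0 : I, j0 \in I by apply/card_gt0P; exact: ltnW.
have <- : #|[set~ j0]| = #|I|.-1 by rewrite cardsC1.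
apply: has_dim_subfamily => [a a_rel | j].
  (* Completing the relation by [0] at [j0], the equation at [j0] kills the
     rank one part of all the others. *)
  pose a' j := if j == j0 then 0 else a j.
  have a'_rel : \sum_j a' j *: phi j = 0.
    rewrite (bigD1 j0) //= /a' eqxx scale0r add0r -[RHS]a_rel.
    apply: eq_big => j; first by rewrite !inE.
    by move=> /negPf ->.
  have eqs l : #|I|%:R * a' l = conj kF (w l) * \sum_j a' j * w j.
    by apply/eqP; rewrite -subr_eq0 -gram_comb a'_rel /inner linear0l.
  have S0 : \sum_j a' j * w j = 0.
    apply/eqP; have /esym/eqP := eqs j0; rewrite {2}/a' eqxx mulr0 mulf_eq0.
    by rewrite fmorph_eq0 (negPf (w_neq0 j0)).
  move=> j; rewrite !inE => neq_j; have /eqP := eqs j.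
  rewrite S0 mulr0 mulf_eq0 pnatr_eq0 -leqn0 leqNgt ltnW //= /a' (negPf neq_j).
  by move/eqP.
have [-> | neq_j] := eqVneq j j0; last first.
  exists (fun l => (l == j)%:R); rewrite (bigD1 j) ?inE //= eqxx scale1r big1 ?addr0 //.
  by move=> l /andP[_ /negPf ->]; rewrite scale0r.
(* Multiply the relation by [w j0], the inverse of [conj (w j0)]. *)
exists (fun l => - (w j0 * conj kF (w l))).
have := congr1 (fun x => w j0 *: x) simplex_relation.
rewrite scaler0 scaler_sumr (bigD1 j0) //= scalerA unit_conj scale1r.
move/eqP; rewrite addr_eq0 => /eqP ->; rewrite -sumrN.
apply: eq_big => l; first by rewrite !inE.
by rewrite scalerA scaleNr.
Qed.

End SimplexFromGram.
End InnerProductFacts.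

(** * Dimension of the span of the columns of a tight frame *)

(** Take a full rank factorisation [Psi = C *m B] and let [Psia] be the conjugate
    transpose of [Psi].  Tightness reads [Psi *m Psia *m Psi = a *: Psi]; cancelling
    [C] on the left and [B] on the right gives [B *m Psia *m C = a%:M], of size the
    rank.  Its trace is that of the Gram matrix [Psia *m Psi] by cyclicity, and the
    columns of [C] are a basis of the span. *)
Lemma tight_frame_dim (R : realType) (kF : scalar_kind) (b n : nat)
    (Psi : 'M[base_field R kF]_(b, n)) (a : R)
    (psi := fun j => col j Psi) (dotF := std_dot R kF b) :
  tight_frame_for dotF psi (in_span psi) a ->
  exists d : nat, has_dim (in_span psi) d /\
    \sum_j inner dotF (psi j) (psi j) = of_real kF a * d%:R.
Proof.
move=> [_ _ tight].
have [r [C [B [PsiE fullC freeB]]]] : exists r (C : 'M_(b, r)) (B : 'M_(r, n)),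
    [/\ C *m B = Psi, row_full C & row_free B].
  exists (\rank Psi), (col_base Psi), (row_base Psi).
  by rewrite mulmx_base col_base_full row_base_free.
exists r.
have combE m (M : 'M[base_field R kF]_(b, m)) (u : 'I_m -> base_field R kF) :
    \sum_j u j *: col j M = M *m (\col_j u j).
  apply/matrixP => i z; rewrite summxE mxE; apply: eq_bigr => j _.
  by rewrite !mxE mulrC.
pose Psia := (map_mx (conj kF) Psi)^T.
have gramE : Psia *m Psi = \matrix_(j, l) inner dotF (psi j) (psi l).
  apply/matrixP => j l; rewrite !mxE /inner /= /coldot.
  by apply: eq_bigr => i _; rewrite !mxE mulrC.
have frameE : Psi *m Psia *m Psi = of_real kF a *: Psi.
  apply/matrixP => i l; have /(congr1 (fun x : 'cV_b => x i 0)) := tight _ (mem_span psi l).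
  rewrite summxE -mulmxA gramE !mxE => <-.
  by apply: eq_bigr => j _; rewrite !mxE mulrC.
split.
  exists (fun l => col l C); split=> [u | x].
    rewrite combE -[0](mulmx0 _ C) => /(row_full_inj fullC) u0 j.
    by have /matrixP/(_ j 0) := u0; rewrite !mxE.
  split=> [[u ->] | [u ->]].
    exists (fun l => (B *m \col_j u j) l 0); rewrite !combE -PsiE -mulmxA.
    by congr (_ *m _); apply/matrixP => l z; rewrite ord1 [RHS]mxE.
  have /row_freeP[B' BB'] := freeB.
  exists (fun j => (B' *m \col_l u l) j 0); rewrite !combE -PsiE -mulmxA.
  congr (_ *m _); apply/matrixP => l z.
  have -> : \col_j (B' *m \col_l u l) j 0 = B' *m \col_l u l.
    by apply/matrixP => j z'; rewrite ord1 mxE.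
  by rewrite mulmxA BB' mul1mx.
have BCE : B *m Psia *m C = (of_real kF a)%:M.
  apply: (row_full_inj fullC); apply: (row_free_inj freeB).
  rewrite /= mul_mx_scalar -scalemxAl PsiE -frameE -[in RHS]PsiE.
  by rewrite !mulmxA.
transitivity (\tr (Psia *m Psi)).
  by apply: eq_bigr => j _; rewrite gramE mxE.
by rewrite -PsiE mulmxA mxtrace_mulC mulmxA BCE mxtrace_scalar mulr_natr.
Qed.

(** * Block designs *)

(** Double count the pairs of a block through [j] and a vertex of it other than
    [j]. *)
Lemma BIBD_replication n k lam b (K : 'I_b -> {set 'I_n}) j :
  BIBD k lam K ->
  (#|[set i | j \in K i]| * k.-1 = lam * n.-1)%N.
Proof.
case=> _ _ _ cardK pairK.
have <- : (\sum_(i | j \in K i) \sum_(l | (l != j) && (l \in K i)) 1 =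
           #|[set i | j \in K i]| * k.-1)%N.
  rewrite -sum_nat_const; apply: eq_big => i; first by rewrite inE.
  move=> jK; rewrite sum1_card -(cardK i) (cardsD1 j) jK /=.
  by rewrite -cardsE; apply: eq_card => l; rewrite !inE.
rewrite (exchange_big_dep (fun l => l != j)) /=; last by move=> i l _ /andP[].
rewrite (eq_bigr (fun=> lam)) => [|l neq_lj]; last first.
  rewrite sum1_card -(pairK j l); last by rewrite eq_sym.
  by apply: eq_card => i; rewrite inE unfold_in neq_lj.
by rewrite sum_nat_const cardC1 card_ord mulnC.
Qed.

Lemma predn_natr_neq0 (F : numFieldType) m : (1 < m)%N -> m.-1%:R != 0 :> F.
Proof. by move=> m_gt1; rewrite pnatr_eq0 -lt0n -subn1 subn_gt0. Qed.

(** * Columns of a phased incidence matrix *)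

Section BlockFrame.
Variables (R : realType) (kF : scalar_kind) (n k lam b : nat).
Variables (K : 'I_b -> {set 'I_n}) (c : 'I_b -> 'I_n -> base_field R kF).
Hypothesis design : BIBD k lam K.
Hypothesis c_unit : forall i j, j \in K i -> `|c i j| = 1.
Hypothesis c_coherent : forall i i' j j', i != i' -> j != j' ->
  j \in K i :&: K i' -> j' \in K i :&: K i' ->
  conj kF (c i j) * c i j' = conj kF (c i' j) * c i' j'.

Let F := base_field R kF.
Let psi := fun j : 'I_n => col j (synthesis lam K c).
Let dotF := std_dot R kF b.

Let lam_gt0 : (0 < lam)%N. Proof. by case: design. Qed.
Let k_gt1 : (1 < k)%N. Proof. by case: design. Qed.
Let n_gt1 : (1 < n)%N.
Proof. by case: design => k1 kn _ _ _; apply: ltn_trans kn. Qed.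

Lemma inner_synthesis j j' : inner dotF (psi j) (psi j') =
  lam%:R^-1 * \sum_(i | (j \in K i) && (j' \in K i)) conj kF (c i j) * c i j'.
Proof.
rewrite /inner /= /coldot mulr_sumr [RHS]big_mkcond /=; apply: eq_bigr => i _.
rewrite !mxE; case: ifP => _; rewrite ?(mul0r, andbF) // andbT.
case: ifP => _; last by rewrite rmorph0 mulr0.
have <- : of_real kF (Num.sqrt lam%:R)^-1 * of_real kF (Num.sqrt lam%:R)^-1 =
    lam%:R^-1 :> F.
  by rewrite -of_realM -invfM -expr2 sqr_sqrtr ?ler0n // of_realV of_real_nat.
by rewrite rmorphM /= conj_of_real; ring.
Qed.

Lemma inner_diag j : inner dotF (psi j) (psi j) = n.-1%:R / k.-1%:R.
Proof.
have k1_neq0 : k.-1%:R != 0 :> F := predn_natr_neq0 _ k_gt1.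
have lam_neq0 : lam%:R != 0 :> F by rewrite pnatr_eq0 -lt0n.
rewrite inner_synthesis (eq_bigr (fun=> 1)) => [|i /andP[jK _]]; last first.
  by rewrite mulrC -normX2_conj c_unit // expr1n.
rewrite sumr_const.
have -> : #|[pred i | (j \in K i) && (j \in K i)]| = #|[set i | j \in K i]|.
  by rewrite -cardsE; apply: eq_card => i; rewrite !inE andbb.
apply: (mulIf k1_neq0); rewrite divfK // -mulrA -natrM (BIBD_replication _ design).
by rewrite natrM mulKf.
Qed.

(** All [lam] terms of the sum in [inner_synthesis] coincide by coherence, and the
    normalisation by [1 / lam] leaves one of them. *)
Lemma inner_block i j j' : j != j' -> j \in K i -> j' \in K i ->
  inner dotF (psi j) (psi j') = conj kF (c i j) * c i j'.
Proof.
move=> neq_j jK j'K; rewrite inner_synthesis.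
rewrite (eq_bigr (fun=> conj kF (c i j) * c i j')) => [|i' /andP[jK' j'K']].
  rewrite sumr_const -cardsE; case: design => _ _ _ _ -> //.
  by rewrite -[X in _ * X]mulr_natl mulKf // pnatr_eq0 -lt0n.
have [-> // | neq_i] := eqVneq i' i.
by apply: c_coherent; rewrite ?inE ?jK ?jK' ?j'K ?j'K'.
Qed.

Lemma norm_inner_offdiag j j' : j != j' ->
  `|inner dotF (psi j) (psi j')| = 1.
Proof.
move=> neq_j.
have : (0 < #|[set i | (j \in K i) && (j' \in K i)]|)%N.
  by case: design => _ _ _ _ ->.
case/card_gt0P => i; rewrite inE => /andP[jK j'K].
by rewrite (inner_block neq_j jK j'K) normrM norm_conj !c_unit ?mulr1.
Qed.

Lemma synthesis_equiangular : equiangular dotF psi.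
Proof.
have k1_neq0 : k.-1%:R != 0 :> F := predn_natr_neq0 _ k_gt1.
have n1_neq0 : n.-1%:R != 0 :> F := predn_natr_neq0 _ n_gt1.
split=> [j | j j' | j j' l l' neq_j neq_l].
- apply/eqP => psi0; have := inner_diag j; rewrite psi0 /inner linear0l.
  by move/esym/eqP; rewrite mulf_eq0 invr_eq0 (negPf n1_neq0) (negPf k1_neq0).
- by rewrite /hnorm !inner_diag.
by rewrite !norm_inner_offdiag.
Qed.

(** Solve [a * g = g ^ 2 + (n - 1)] for [a], where [g = (n - 1) / (k - 1)]. *)
Lemma synthesis_frame_bound a : tight_frame_for dotF psi (in_span psi) a ->
  of_real kF a = n.-1%:R / k.-1%:R + k.-1%:R.
Proof.
move=> tight.
have k1_neq0 : k.-1%:R != 0 :> F := predn_natr_neq0 _ k_gt1.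
have n1_neq0 : n.-1%:R != 0 :> F := predn_natr_neq0 _ n_gt1.
have l : 'I_n by exact: Ordinal n_gt1.
have := tight_frame_norm l tight; rewrite inner_diag (bigD1 l) // inner_diag.
rewrite (eq_bigr (fun=> 1)) => [|j neq_j]; last first.
  by rewrite norm_inner_offdiag // expr1n.
rewrite sumr_const cardC1 card_ord.
rewrite ger0_norm ?divr_ge0 ?ler0n // => tightE.
apply: (mulIf (mulf_neq0 n1_neq0 (invr_neq0 k1_neq0))); rewrite tightE.
by rewrite mulrDl -expr2 [_ * (_ / _)]mulrC divfK.
Qed.

Lemma synthesis_dim a : tight_frame_for dotF psi (in_span psi) a ->
  exists d : nat, has_dim (in_span psi) d /\
    d%:R = n%:R * (n%:R - 1) / ((n%:R - 1) + (k%:R - 1) ^+ 2) :> rat.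
Proof.
move=> tight; have [d [dimd traceE]] := tight_frame_dim tight.
exists d; split=> //.
have k1_neq0 : k.-1%:R != 0 :> F := predn_natr_neq0 _ k_gt1.
(* The formula without division; characteristic zero descends it to [nat]. *)
have dE : (d * (n.-1 + k.-1 ^ 2) = n * n.-1)%N.
  apply/eqP; rewrite -(eqr_nat F) !natrM natrD natrX; apply/eqP.
  move: traceE; rewrite (synthesis_frame_bound tight).
  under eq_bigr => j _ do rewrite inner_diag.
  rewrite sumr_const card_ord => traceE; rewrite -[LHS]mulr_natl in traceE.
  apply: (mulIf (invr_neq0 k1_neq0)).
  rewrite -[RHS]mulrA traceE -mulrA [RHS]mulrC; congr (_ * _).
  by rewrite mulrDl expr2 mulfK.
have predE m : (1 < m)%N -> m%:R - 1 = m.-1%:R :> rat.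
  by move=> m1; rewrite -{1}(prednK (ltnW m1)) -natr1 addrK.
rewrite !predE // -natrX -natrD -natrM -dE natrM mulfK //.
by rewrite pnatr_eq0 -lt0n addn_gt0 -subn1 subn_gt0 n_gt1.
Qed.

(** The frame bound cancels [g] on the diagonal and leaves [k - 1], so that the
    Gram matrix has the form treated in [regular_simplex_of_gram]. *)
Lemma naimark_block_simplex (H : lmodType (base_field R kF))
    (dotH : {dot H for conj kF}) (phi : 'I_n -> H) i :
  naimark_complement dotF dotH psi phi ->
  regular_simplex dotH (fun j : {j : 'I_n | j \in K i} => phi (val j)).
Proof.
case=> _ [a [tight _ gramE]].
have cardI : #|{: {j : 'I_n | j \in K i}}| = k.
  by rewrite card_sig; case: design => _ _ _ /(_ i) <- _; exact: eq_card.
apply: (@regular_simplex_of_gram _ _ _ _ _ _ (fun j => c i (val j))).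
- by rewrite cardI.
- by move=> j; apply: c_unit; exact: (valP j).
move=> j l; rewrite gramE cardI (synthesis_frame_bound tight) val_eqE.
have [<- | neq_jl] := eqVneq j l; last first.
  by rewrite !mulr0n (inner_block (i := i)) ?val_eqE //; [exact: valP|exact: valP].
rewrite inner_diag !mulr1n [_ + k.-1%:R]addrC addrK.
rewrite [conj _ _ * _]mulrC -normX2_conj c_unit ?(valP j) // expr1n.
by rewrite -{2}(prednK (ltnW k_gt1)) -natr1 addrK.
Qed.

End BlockFrame.

Theorem theorem5p2 (R : realType) (kF : scalar_kind) (n k lam b : nat)
    (K : 'I_b -> {set 'I_n}) (c : 'I_b -> 'I_n -> base_field R kF) :
  BIBD k lam K ->
  (forall i j, j \in K i -> `|c i j| = 1) ->
  (forall i i' j j', i != i' -> j != j' ->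
     j \in K i :&: K i' -> j' \in K i :&: K i' ->
     conj kF (c i j) * c i j' = conj kF (c i' j) * c i' j') ->
  let psi := fun j : 'I_n => col j (synthesis lam K c) in
  let dotF := std_dot R kF b in
  equiangular dotF psi /\
  (ETF_for dotF psi (in_span psi) ->
     (exists d : nat, has_dim (in_span psi) d /\
        d%:R = n%:R * (n%:R - 1) / ((n%:R - 1) + (k%:R - 1) ^+ 2) :> rat) /\
     (forall (H : lmodType (base_field R kF)) (dotH : {dot H for conj kF})
        (phi : 'I_n -> H),
        naimark_complement dotF dotH psi phi ->
        forall i : 'I_b,
          regular_simplex dotH (fun j : {j : 'I_n | j \in K i} => phi (val j)))).
Proof.
move=> design c_unit c_coherent psi dotF; split.
  exact: (synthesis_equiangular design).
move=> [_ [a tight]]; split.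
  exact: (synthesis_dim design c_unit c_coherent tight).
move=> H dotH phi naimark i.
exact: (naimark_block_simplex design c_unit c_coherent i naimark).
Qed.
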